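(* Let $G$ be a group such that the core quandle $\operatorname{Core} G=(G,s)$ is nontrivial, and let $T$ be the subgroup \[ T:=\{z\in Z(G)\mid z^2=1\} \] of the center $Z(G)$. Then for all functions $\rho:G\to G$, $\rho$ is a good involution of $\operatorname{Core} G$ if and only if there exists a function $\alpha:G\to T$ such that \[ \rho(g)=\alpha(g)g,\qquad \alpha s_g=\alpha=\alpha\rho \] for all $g\in G$, where juxtaposition of functions denotes composition.
   Context: A rack is a pair $R=(X,s)$ where $X$ is a nonempty set and $s:X\to S_X$, $x\mapsto s_x$, is a map to the symmetric group of $X$ with $s_xs_y=s_{s_x(y)}s_x$ for all $x,y\in X$. A quandle is a rack with $s_x(x)=x$ for all $x$; it is trivial if $s_x=\mathrm{id}_X$ for all $x$. For a group $G$, the core quandle $\operatorname{Core} G=(G,s)$ is given by $s_g(h)=gh^{-1}g$ for $g,h\in G$. A good involution of a rack $(X,s)$ is a map $\rho:X\to X$ with $\rho^2=\mathrm{id}_X$ (the identity is allowed) such that $\rho s_x=s_x\rho$ and $s_{\rho(x)}=s_x^{-1}$ for all $x\in X$. *)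

(* Defs.v *)
From HB Require Import structures.
From mathcomp Require Import all_boot.
From mathcomp Require Import boolp classical_sets functions.

Set Implicit Arguments.
Unset Strict Implicit.
Unset Printing Implicit Defensive.

Local Open Scope classical_set_scope.
Local Open Scope group_scope.

(* A permutation is stored with its inverse, written [f^-1%FUN] ; being
   two-sided on all of X, that inverse is determined by f. *)
Definition symmetric_group (X : Type) := {splitbij [set: X] >-> [set: X]}.

Record rack := Rack {
  rack_sort :> Type;
  rack_nonempty : inhabited rack_sort;
  rack_sym : rack_sort -> symmetric_group rack_sort;
  rack_symD : forall x y : rack_sort,
    rack_sym x \o rack_sym y =1 rack_sym (rack_sym x y) \o rack_sym x }.

Record quandle := Quandle {
  quandle_rack :> rack;
  quandle_sym_fix : forall x : quandle_rack, rack_sym x x = x }.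

Definition trivial_quandle (Q : quandle) : Prop :=
  forall x : Q, rack_sym x =1 id.

Definition good_involution (R : rack) (rho : R -> R) : Prop :=
  involutive rho /\
  forall x : R, rho \o rack_sym x =1 rack_sym x \o rho
             /\ rack_sym (rho x) =1 (rack_sym x)^-1%FUN.

Section CoreQuandle.
Variable G : groupType.

Definition core_sym (g h : G) : G := g * h^-1 * g.

Lemma core_symK (g : G) : involutive (core_sym g).
Proof. by move=> h; rewrite /core_sym !invgM invgK !mulgA mulgV mul1g mulgVK. Qed.

HB.instance Definition _ (g : G) :=
  @Can2.Build G G [set: G] [set: G] (core_sym g) (core_sym g)
    (fun _ _ => I) (fun _ _ => I)
    (fun h _ => core_symK g h) (fun h _ => core_symK g h).

Definition core_perm (g : G) : symmetric_group G := core_sym g.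

Lemma core_symD (x y : G) :
  core_perm x \o core_perm y =1 core_perm (core_perm x y) \o core_perm x.
Proof.
move=> h; rewrite /= /core_sym !invgM !invgK !mulgA.
by rewrite !mulgVK mulgK.
Qed.

Lemma core_sym_fix (g : G) : core_perm g g = g.
Proof. by rewrite /= /core_sym mulgV mul1g. Qed.

Definition Core : quandle :=
  @Quandle (@Rack G (inhabits 1) core_perm core_symD) core_sym_fix.

Definition center : set G := [set z | forall x : G, commute z x].

Definition center2 : set G := [set z | center z /\ z ^+ 2 = 1].

Lemma center2_group_closed : group_closed (mem center2).
Proof.
split=> [|x y]; rewrite !in_setE.
  by split; [move=> x; apply/commute_sym/commute1 | rewrite expg1n].
move=> [cx x2] [cy y2]; split=> [z|].
  by apply/commute_sym/commuteM; [|apply: commuteV]; apply/commute_sym.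
by rewrite expgnFl ?x2 ?y2 ?invg1 ?mulg1 //; apply: cx.
Qed.

End CoreQuandle.

Arguments center G : clear implicits.
Arguments center2 G : clear implicits.

(* Main.v *)
(** Every s_x is an involution, so s_(rho x) = s_x^-1 says s_(rho x) = s_x, and
    this holds exactly when z = rho x * x^-1 lies in T: the equation at h^-1
    reads (x^-1 * rho x) * h * z = h, so h = 1 gives x^-1 * rho x = z^-1, then z
    is central, and so z = x^-1 * rho x = z^-1.  Given this, with
    alpha x := rho x * x^-1, commutation of rho with s_g amounts to
    alpha s_g = alpha, and rho^2 = id to alpha rho = alpha, because the values
    of alpha are their own inverses. *)

Require Import Defs.
From HB Require Import structures.
From mathcomp Require Import all_boot.
From mathcomp Require Import boolp classical_sets functions.

Local Open Scope classical_set_scope.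
Local Open Scope group_scope.

Lemma center2V {G : groupType} {z : G} : center2 G z -> z^-1 = z.
Proof. by move=> [_ z2]; rewrite -[LHS]mulg1 -z2 expg2 mulKg. Qed.

(** Inverting [z * h] turns the central factor into [z^-1], which is [z] again. *)
Lemma core_symMr {G : groupType} (z g h : G) :
  center2 G z -> core_sym g (z * h) = z * core_sym g h.
Proof.
move=> zT; have [zC _] := zT.
by rewrite /core_sym invgM (center2V zT) !mulgA -(zC (g * _)) !mulgA.
Qed.

(** The central factor [z] enters twice, and [z^2 = 1]. *)
Lemma core_symMl {G : groupType} (z g : G) :
  center2 G z -> core_sym (z * g) =1 core_sym g.
Proof.
move=> [zC z2] h; rewrite /core_sym -(mulgA z g) (zC (g * _)) -mulgA.
by rewrite (mulgA z z) -expg2 z2 mul1g.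
Qed.

Lemma core_sym_eq_center2 {G : groupType} (x y : G) :
  core_sym y =1 core_sym x -> center2 G (y * x^-1).
Proof.
move=> syx.
set z := y * x^-1.
have conj_fix h : x^-1 * y * h * z = h.
  have /(congr1 (fun k => x^-1 * k * x^-1)) := syx h^-1.
  by rewrite /core_sym invgK !mulgA mulVg mul1g mulgK.
have xyV : x^-1 * y = z^-1.
  by rewrite -[LHS](mulgK z) -{1}[x^-1 * y]mulg1 conj_fix mul1g.
have zC h : z * h = h * z by rewrite -{1}(conj_fix h) xyV !mulgA mulgV mul1g.
split=> //=; rewrite expg2 -[in RHS](mulgV z) -xyV.
(* Since [y = z * x] with [z] central, [x^-1 * y = x^-1 * (x * z) = z]. *)
by rewrite -(mulgVK x y) -/z (zC x) mulKg.
Qed.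

Theorem theorem1p4 (G : groupType) (core_nontrivial : ~ trivial_quandle (Core G))
    (rho : G -> G) :
  good_involution (R := Core G) rho <->
  exists alpha : G -> center2 G,
    forall g : G,
      [/\ rho g = val (alpha g) * g,
          alpha \o (rack_sym (r := Core G) g) =1 alpha
        & alpha \o rho =1 alpha].
Proof.
split=> [[rhoK rho_good]|[alpha alphaP]].
  have rhoT g : center2 G (rho g * g^-1).
    by apply: core_sym_eq_center2; apply: (rho_good g).2.
  have rho_sym g h : rho (core_sym g h) = core_sym g (rho h).
    exact: (rho_good g).1.
  exists (fun g => SigSub (mem_set (rhoT g))) => g; split=> [|h|h] /=.
  - by rewrite mulgVK.
  (* Split [rho h] as [(rho h * h^-1) * h], so that its factor in T can be pulled out of
     [core_sym g]. *)
  - apply: val_inj => /=; rewrite rho_sym -{1}(mulgVK h (rho h)).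
    by rewrite core_symMr // mulgK.
  - by apply: val_inj; rewrite /= rhoK -(center2V (rhoT h)) invgM invgK.
have alphaT g : center2 G (val (alpha g)) by exact: set_mem (valP (alpha g)).
have rhoE g : rho g = val (alpha g) * g by case: (alphaP g).
split=> [g|x].
  have [_ _ /(_ g) /= alpha_rho] := alphaP g.
  by rewrite rhoE alpha_rho rhoE mulgA -expg2 (alphaT g).2 mul1g.
split=> h /=.
  have [_ /(_ h) /= alpha_sym _] := alphaP x.
  by rewrite rhoE alpha_sym rhoE core_symMr.
by rewrite rhoE core_symMl.
Qed.
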